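(* Let $\Sigma$ be a finite nonempty alphabet and let $x_1, x_2, \ldots, x_k \in \Sigma^+$ be nonempty words. Then $L = x_1^* x_2^* \cdots x_k^*$ is co-finite (i.e. $\Sigma^* \setminus L$ is finite) if and only if $|\Sigma| = 1$ and $\gcd(|x_1|, \ldots, |x_k|) = 1$. *)

(* Defs.v *)
From mathcomp Require Import all_boot.
From mathcomp Require Import classical_sets cardinality.

Set Implicit Arguments.
Unset Strict Implicit.
Unset Printing Implicit Defensive.

Local Open Scope classical_set_scope.

Definition language (Sigma : Type) := set (seq Sigma).

Definition lang_cat (Sigma : Type) (A B : language Sigma) : language Sigma :=
  [set u ++ v | u in A & v in B].

Definition word_exp (Sigma : Type) (w : seq Sigma) (n : nat) : seq Sigma :=
  flatten (nseq n w).

(* w^* = {w}^* = {w^n : n >= 0} *)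
Definition word_star (Sigma : Type) (w : seq Sigma) : language Sigma :=
  [set word_exp w n | n in [set: nat]].

(* x_0^* x_1^* ... x_(k-1)^*, in increasing order of the index *)
Definition star_product (Sigma : Type) (k : nat) (x : 'I_k -> seq Sigma) :
    language Sigma :=
  \big[@lang_cat Sigma/[set [::]]]_(i < k) word_star (x i).

(* Main.v *)
(* Over at least two letters, the at least 2^N words of length N cannot all be
   among the at most (N+1)^k products of powers x_i^(e_i) with e_i <= N.
   Moreover every length occurring in L is divisible by the gcd of the |x_i|,
   so a co-finite L forces this gcd to divide two consecutive integers.
   Conversely a word over a single letter is determined by its length, and every
   large enough multiple of the gcd is a combination of the |x_i| with
   nonnegative coefficients. *)
Require Import Defs.
From mathcomp Require Import all_boot.
From mathcomp Require Import zify boolp.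
From mathcomp Require Import classical_sets cardinality.

Lemma size_word_exp (T : Type) (w : seq T) (n : nat) :
  size (word_exp w n) = n * size w.
Proof.
by rewrite /word_exp size_flatten /shape map_nseq sumn_nseq mulnC.
Qed.

Lemma size_big_cat (T : Type) (k : nat) (f : 'I_k -> seq T) :
  size (\big[cat/[::]]_(i < k) f i) = \sum_(i < k) size (f i).
Proof. by apply: (big_morph size) => [u v|] //; rewrite size_cat. Qed.

(** The exponents form a map on [nat] rather than on ['I_k], so that the induction on [k] can
    prepend one by matching on the index. *)
Lemma star_productP (T : Type) (k : nat) (x : 'I_k -> seq T) (w : seq T) :
  star_product x w <->
  exists e : nat -> nat, w = \big[cat/[::]]_(i < k) word_exp (x i) (e i).
Proof.
rewrite /star_product; elim: k x w => [|k IHk] x w.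
  rewrite big_ord0; split=> [->|[e]]; last by rewrite big_ord0.
  by exists id; rewrite big_ord0.
rewrite big_ord_recl; split.
  case=> _ [n _ <-] [v /IHk [e ->] <-].
  exists (fun i => if i is j.+1 then e j else n).
  by rewrite big_ord_recl.
case=> e ->; rewrite big_ord_recl.
exists (word_exp (x ord0) (e 0)); first by exists (e 0).
exists (\big[cat/[::]]_(i < k) word_exp (x (lift ord0 i)) (e i.+1)) => //.
by apply/IHk; exists (fun i => e i.+1).
Qed.

Lemma cofinite_long_words (T : choiceType) (L : language T) :
  cofinite_set L -> exists N, forall w : seq T, N <= size w -> L w.
Proof.
move=> /finite_seqP[s Es]; exists (\max_(w <- s) size w).+1 => w ltw.
apply: contrapT => NLw.
have ws : w \in s by have : (~` L)%classic w by []; rewrite Es.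
by move: ltw; rewrite ltnNge (leq_bigmax_seq _ ws isT).
Qed.

Lemma exists_expn_lt_exp2n (k N : nat) :
  exists2 n, N <= n & n.+1 ^ k < 2 ^ n.
Proof.
(* The summand 5 lets the induction below start at [25 < 31]. *)
set m := k + N + 5.
have lt_m : m * m < (2 ^ m).-1.
  rewrite /m; elim: (k + N) => [//|p IHp].
  rewrite addSn expnS; move: IHp; have := leq_addl p 5.
  set q := p + 5; set t := 2 ^ q; nia.
(* For this [n], [n.+1 ^ k = 2 ^ (m * k)], so [m * k < (2 ^ m).-1] suffices. *)
exists (2 ^ m).-1; first by move: lt_m; rewrite /m; nia.
rewrite prednK ?expn_gt0// -expnM ltn_exp2l//; apply: leq_trans lt_m.
by rewrite ltnS leq_mul2l /m; lia.
Qed.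

Lemma polynomial_star_product (T : finType) (k N : nat) (x : 'I_k -> seq T) :
  (forall i, x i <> [::]) ->
  (forall w : seq T, size w = N -> star_product x w) -> #|T| ^ N <= N.+1 ^ k.
Proof.
move=> x0 LN; set f := fun e : {ffun 'I_k -> 'I_N.+1} =>
  \big[cat/[::]]_(i < k) word_exp (x i) (e i).
have -> : #|T| ^ N = size (map val (enum {: N.-tuple T})).
  by rewrite size_map -cardE card_tuple.
have -> : N.+1 ^ k = size (map f (enum {: {ffun 'I_k -> 'I_N.+1}})).
  by rewrite size_map -cardE card_ffun !card_ord.
apply: uniq_leq_size; first by rewrite (map_inj_uniq val_inj) enum_uniq.
move=> _ /mapP[t _ ->]; have /star_productP[e te] := LN _ (size_tuple t).
(* As [x i] is nonempty, its [e i] copies take up at least [e i] of the [N] letters. *)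
have leN (i : 'I_k) : e i < N.+1.
  have := size_tuple t; rewrite te size_big_cat (bigD1 i)//= size_word_exp.
  by have := x0 i; case: (x i) => [//|a s] _ /=; nia.
apply/mapP; exists [ffun i => Ordinal (leN i)]; first by rewrite mem_enum.
by rewrite /= te /f; apply: eq_bigr => i _; rewrite ffunE.
Qed.

Lemma dvdn_size_star_product (T : Type) (k : nat) (x : 'I_k -> seq T) w :
  star_product x w -> \big[gcdn/0]_(i < k) size (x i) %| size w.
Proof.
move=> /star_productP[e ->]; rewrite size_big_cat; apply: dvdn_sum => i _.
by rewrite size_word_exp dvdn_mull// (bigD1 i)//= dvdn_gcdl.
Qed.

(* The coefficient u is taken modulo b, so that u * a stays bounded. *)
Lemma gcdn_large_multiple (a b : nat) : 0 < b ->
  exists B, forall n, gcdn a b %| n -> B <= n ->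
    exists2 u, u * a <= B & b %| n - u * a.
Proof.
move=> b_gt0; exists (b * a) => n /dvdnP[q Eq] le_n.
have [c cP] : exists c, c * a = gcdn a b %[mod b].
  case: (posnP a) => [->|a_gt0].
    by exists 0; rewrite gcd0n modnn mod0n.
  (* Bezout in the form [gcdn a b + c * b = d * a], with natural coefficients: [d] is the
     witness. *)
  have [c _ /dvdnP[d dE]] := Bezoutl b a_gt0.
  by exists d; rewrite -dE addnC modnMDl.
have leb : ((q * c) %% b) * a <= b * a.
  by rewrite leq_mul2r ltnW ?orbT// ltn_mod.
exists ((q * c) %% b) => //; rewrite -eqn_mod_dvd ?(leq_trans leb)//.
by rewrite modnMml -mulnA -modnMmr cP modnMmr -Eq.
Qed.

(** By induction on [k]: a bounded multiple of [s ord0] corrects [n] modulo the gcd of the other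
    terms, and what is left is still large enough to be a combination of those. *)
Lemma gcdn_large_combination (k : nat) (s : 'I_k -> nat) :
  exists N, forall n, N <= n -> \big[gcdn/0]_(i < k) s i %| n ->
    exists e : nat -> nat, n = \sum_(i < k) e i * s i.
Proof.
elim: k s => [|k IHk] s.
  exists 0 => n _; rewrite big_ord0 dvd0n => /eqP ->.
  by exists id; rewrite big_ord0.
have [N NP] := IHk (fun i => s (lift ord0 i)).
have cons_sum u m : (exists e : nat -> nat,
    m = \sum_(i < k) e i * s (lift ord0 i)) ->
    exists e : nat -> nat, u * s ord0 + m = \sum_(i < k.+1) e i * s i.
  move=> [e ->]; exists (fun i => if i is j.+1 then e j else u).
  by rewrite big_ord_recl.
rewrite big_ord_recl; set g := \big[gcdn/0]_(i < k) _ in NP *.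
(* If [g = 0], the other terms are all zero or absent, and [n] is a multiple of [s ord0] alone. *)
have [g0|g_gt0] := posnP g.
  exists 0 => n _; rewrite g0 gcdn0 => /dvdnP[q ->].
  rewrite -[q * _]addn0; apply: cons_sum; exists (fun=> 0).
  by rewrite big1.
have [B BP] := gcdn_large_multiple (s ord0) _ g_gt0.
(* [B] caps the subtracted multiple, so at least [N] remains for the induction hypothesis. *)
exists (B + N) => n le_n gn; have [|u uB gu] := BP n gn; first lia.
have un : u * s ord0 <= n by lia.
rewrite -(subnKC un); apply: cons_sum; apply: NP => //; lia.
Qed.

Lemma unary_words_eq (T : finType) (u v : seq T) :
  #|T| = 1 -> size u = size v -> u = v.
Proof.
move=> T1; have /fintype_le1P T1P : #|T| <= 1 by rewrite T1.
elim: u v => [|a u IHu] [|b v]//= [] /IHu ->.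
by rewrite (T1P a b).
Qed.

Theorem theorem5 (Sigma : finType) (Sigma_nonempty : 0 < #|Sigma|)
    (k : nat) (x : 'I_k -> seq Sigma) (x_nonempty : forall i, x i <> [::]) :
  cofinite_set (star_product x) <->
  #|Sigma| = 1 /\ \big[gcdn/0]_(i < k) size (x i) = 1.
Proof.
have /card_gt0P[a _] := Sigma_nonempty.
split=> [/cofinite_long_words[N LN]|[Sigma1 gcd1]].
  split.
    apply/eqP; rewrite eqn_leq Sigma_nonempty andbT leqNgt; apply/negP => gt1.
    have [n le_n] := exists_expn_lt_exp2n k N; rewrite ltnNge => /negP; apply.
    have := @polynomial_star_product _ _ n x x_nonempty.
    move=> /(_ (fun w En => LN w (leq_trans le_n (eq_leq (esym En))))).
    by apply: leq_trans; case: n {le_n} => // n; rewrite leq_exp2r.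
  (* The constant words [nseq n a] realise every length from [N] on. *)
  have dvd n : N <= n -> \big[gcdn/0]_(i < k) size (x i) %| n.
    move=> le_n; rewrite -(size_nseq n a); apply: dvdn_size_star_product.
    by apply: LN; rewrite size_nseq.
  apply/eqP; rewrite -dvdn1 -(dvdn_addr 1 (dvd N (leqnn N))) addn1.
  exact: dvd.
have [N NP] := gcdn_large_combination k (fun i => size (x i)).
(* Only the powers of the single letter [a] of length below [N] can lie outside the product. *)
apply: (@sub_finite_set _ _ [set nseq n a | n in `I_N]%classic); last first.
  exact/finite_image/finite_II.
move=> w NLw; exists (size w); last first.
  by apply: unary_words_eq; rewrite ?size_nseq.
rewrite /= ltnNge; apply/negP => le_w; apply: NLw; apply/star_productP.
have [|e ew] := NP _ le_w; first by rewrite gcd1.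
exists e; apply: unary_words_eq => //; rewrite ew size_big_cat.
by apply: eq_bigr => i _; rewrite size_word_exp.
Qed.
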